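(* For every set $\mathcal F$ of LTLf formulae and all LTLf formulae $\varphi,\psi$: $\mathcal F\cup\{\varphi\}\vdash\psi$ if and only if $\mathcal F\vdash\Box\varphi\Rightarrow\psi$.
   Context: Fix a set $\mathrm{Var}$ of propositional variables. LTLf formulae are generated by $\varphi,\psi ::= v \mid \bot \mid \varphi\Rightarrow\psi \mid \mathsf{X}\varphi \mid \varphi\,\mathcal{W}\,\psi$ with $v\in\mathrm{Var}$. Abbreviations: $\neg\varphi := \varphi\Rightarrow\bot$; $\top:=\neg\bot$; $\varphi\vee\psi := \neg\varphi\Rightarrow\psi$; $\varphi\wedge\psi := \neg(\neg\varphi\vee\neg\psi)$; $\varphi\Leftrightarrow\psi := (\varphi\Rightarrow\psi)\wedge(\psi\Rightarrow\varphi)$; $\mathsf{end} := \neg\mathsf{X}\top$; $\bullet\varphi := \neg\mathsf{X}\neg\varphi$; $\Box\varphi := \varphi\,\mathcal{W}\,\bot$; $\Diamond\varphi := \neg\Box\neg\varphi$. Proof system: derivability is closed under propositional reasoning (all instances of propositional tautologies; modus ponens) together with: (WkNextDistr) $\bullet(\varphi\Rightarrow\psi)\Leftrightarrow(\bullet\varphi\Rightarrow\bullet\psi)$; (EndNextContra) $\mathsf{end}\Rightarrow\neg\mathsf{X}\varphi$; (Finite) $\Diamond\mathsf{end}$; (WkUntilUnroll) $\varphi\,\mathcal W\,\psi\Leftrightarrow\psi\vee(\varphi\wedge\bullet(\varphi\,\mathcal W\,\psi))$; (WkNextStep) from $\varphi$ infer $\bullet\varphi$; (Induction) from $\varphi\Rightarrow\psi$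 and $\varphi\Rightarrow\bullet\varphi$ infer $\varphi\Rightarrow\Box\psi$. For a set $\mathcal F$ of formulae, $\mathcal F\vdash\varphi$ means $\varphi$ is derivable in this system with every member of $\mathcal F$ added as an extra axiom. *)

(* Defs.v *)
From Stdlib Require Export Ensembles.

Set Implicit Arguments.

Inductive formula (Var : Type) : Type :=
| Atom (v : Var)
| Bot
| Imp (phi psi : formula Var)
| Next (phi : formula Var)
| WUntil (phi psi : formula Var).

Arguments Bot {Var}.

Definition Neg (Var : Type) (phi : formula Var) : formula Var := Imp phi Bot.
Definition Top {Var : Type} : formula Var := Neg Bot.
Definition Or (Var : Type) (phi psi : formula Var) : formula Var :=
  Imp (Neg phi) psi.
Definition And (Var : Type) (phi psi : formula Var) : formula Var :=
  Neg (Or (Neg phi) (Neg psi)).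
Definition Iff (Var : Type) (phi psi : formula Var) : formula Var :=
  And (Imp phi psi) (Imp psi phi).
Definition End_ {Var : Type} : formula Var := Neg (Next Top).
Definition WNext (Var : Type) (phi : formula Var) : formula Var :=
  Neg (Next (Neg phi)).
Definition Always (Var : Type) (phi : formula Var) : formula Var := WUntil phi Bot.
Definition Eventually (Var : Type) (phi : formula Var) : formula Var :=
  Neg (Always (Neg phi)).

(* Propositional schemata: an instance of a tautology replaces each
   schematic letter by an arbitrary LTLf formula. *)
Inductive pform : Type :=
| PLetter (n : nat)
| PBot
| PImp (p q : pform).

Fixpoint peval (e : nat -> bool) (p : pform) : bool :=
  match p with
  | PLetter n => e n
  | PBot => false
  | PImp p q => implb (peval e p) (peval e q)
  end.

Definition tautology (p : pform) : Prop :=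
  forall e : nat -> bool, peval e p = true.

Fixpoint pinst (Var : Type) (s : nat -> formula Var) (p : pform)
  : formula Var :=
  match p with
  | PLetter n => s n
  | PBot => Bot
  | PImp p q => Imp (pinst s p) (pinst s q)
  end.

(* The members of [F] are axioms, so every rule, including [WkNextStep] and
   [Induction], applies to formulae derived from them. *)
Inductive derivable (Var : Type) (F : Ensemble (formula Var))
  : formula Var -> Prop :=
| Assumption phi : In _ F phi -> derivable F phi
| Tautology p s : tautology p -> derivable F (pinst s p)
| ModusPonens phi psi :
    derivable F (Imp phi psi) -> derivable F phi -> derivable F psi
| WkNextDistr phi psi :
    derivable F (Iff (WNext (Imp phi psi)) (Imp (WNext phi) (WNext psi)))
| EndNextContra phi : derivable F (Imp End_ (Neg (Next phi)))
| Finite : derivable F (Eventually End_)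
| WkUntilUnroll phi psi :
    derivable F (Iff (WUntil phi psi)
                     (Or psi (And phi (WNext (WUntil phi psi)))))
| WkNextStep phi : derivable F phi -> derivable F (WNext phi)
| Induction phi psi :
    derivable F (Imp phi psi) -> derivable F (Imp phi (WNext phi)) ->
    derivable F (Imp phi (Always psi)).

(* Main.v *)
(** Since [Always phi] implies its own weak next, prefixing every formula of a
    derivation with [Always phi] is compatible with [WkNextStep], and with
    [Induction] once the invariant [chi] is strengthened to
    [And (Always phi) chi].  Conversely, [Induction] with invariant [Top] turns
    the axiom [phi] into [Always phi]. *)

Require Import Defs.

Set Implicit Arguments.

(** Three letters suffice for every propositional step below; where fewer are needed, one is
    repeated as padding. *)
Definition letters (Var : Type) (a b c : formula Var) (n : nat) :
  formula Var :=
  match n with 0 => a | 1 => b | _ => c end.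

(** Inverts [pinst]. The letters are tried first, so a compound formula passed as a letter is not
    decomposed. *)
Ltac reify a b c t :=
  lazymatch t with
  | a => constr:(PLetter 0)
  | b => constr:(PLetter 1)
  | c => constr:(PLetter 2)
  | Bot => constr:(PBot)
  | Imp ?t1 ?t2 =>
      let p := reify a b c t1 in
      let q := reify a b c t2 in
      constr:(PImp p q)
  end.

(* [WNext] stays folded: its instances must be matched as letters. *)
Ltac by_tautology a b c :=
  unfold Iff, And, Or, Top, Neg;
  lazymatch goal with
  | |- derivable ?F ?t =>
      let p := reify a b c t in
      change (derivable F (pinst (letters a b c) p));
      apply Tautology; let e := fresh "e" in intro e; cbn;
      destruct (e 0), (e 1), (e 2); reflexivity
  end.

Section Derivability.

Variables (Var : Type) (F : Ensemble (formula Var)).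
Implicit Types a b c chi : formula Var.

Lemma derivable_weaken (G : Ensemble (formula Var)) chi :
  Included _ F G -> derivable F chi -> derivable G chi.
Proof.
  intros FG D; induction D;
    eauto using Assumption, Tautology, ModusPonens, WkNextDistr, EndNextContra,
      Finite, WkUntilUnroll, WkNextStep, Induction.
Qed.

Lemma imp_const a b : derivable F b -> derivable F (Imp a b).
Proof. apply ModusPonens; by_tautology a b a. Qed.

Lemma imp_trans a b c :
  derivable F (Imp a b) -> derivable F (Imp b c) -> derivable F (Imp a c).
Proof.
  intros Hab Hbc.
  apply (ModusPonens (phi := Imp b c)); [|exact Hbc].
  apply (ModusPonens (phi := Imp a b)); [|exact Hab].
  by_tautology a b c.
Qed.

(** The S combinator: it carries [ModusPonens] out under a common prefix [a]. *)
Lemma imp_mp a b c :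
  derivable F (Imp a (Imp b c)) -> derivable F (Imp a b) ->
  derivable F (Imp a c).
Proof.
  intros Habc Hab.
  apply (ModusPonens (phi := Imp a b)); [|exact Hab].
  apply (ModusPonens (phi := Imp a (Imp b c))); [|exact Habc].
  by_tautology a b c.
Qed.

Lemma imp_uncurry a b c :
  derivable F (Imp a (Imp b c)) -> derivable F (Imp (And a b) c).
Proof. apply ModusPonens; by_tautology a b c. Qed.

Lemma imp_curry a b c :
  derivable F (Imp (And a b) c) -> derivable F (Imp a (Imp b c)).
Proof. apply ModusPonens; by_tautology a b c. Qed.

Lemma iff_imp a b : derivable F (Iff a b) -> derivable F (Imp a b).
Proof. apply ModusPonens; by_tautology a b a. Qed.

Lemma wnext_distr a b :
  derivable F (Imp (WNext (Imp a b)) (Imp (WNext a) (WNext b))).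
Proof.
  apply (ModusPonens (phi := Iff (WNext (Imp a b)) (Imp (WNext a) (WNext b)))).
  - by_tautology (WNext (Imp a b)) (WNext a) (WNext b).
  - apply WkNextDistr.
Qed.

Lemma wnext_mono a b :
  derivable F (Imp a b) -> derivable F (Imp (WNext a) (WNext b)).
Proof.
  intro H; exact (ModusPonens (wnext_distr a b) (WkNextStep H)).
Qed.

(** Push the tautology [a => b => And a b] through the weak next, then distribute over the inner
    implication. *)
Lemma wnext_and a b :
  derivable F (Imp (WNext a) (Imp (WNext b) (WNext (And a b)))).
Proof.
  apply imp_trans with (WNext (Imp b (And a b))); [|apply wnext_distr].
  apply wnext_mono; by_tautology a b a.
Qed.

Lemma always_unroll a :
  derivable F (Imp (Always a) (And a (WNext (Always a)))).
Proof.
  apply imp_trans with (Or Bot (And a (WNext (Always a)))).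
  - apply iff_imp, WkUntilUnroll.
  - by_tautology a (WNext (Always a)) a.
Qed.

Lemma always_now a : derivable F (Imp (Always a) a).
Proof.
  apply imp_trans with (1 := always_unroll a).
  by_tautology a (WNext (Always a)) a.
Qed.

(** Together with [always_now], this is all that the forward direction uses about [Always]. *)
Lemma always_wnext a : derivable F (Imp (Always a) (WNext (Always a))).
Proof.
  apply imp_trans with (1 := always_unroll a).
  by_tautology a (WNext (Always a)) a.
Qed.

Lemma always_intro a : derivable F a -> derivable F (Always a).
Proof.
  intro H.
  assert (T : derivable F Top) by by_tautology a a a.
  apply (ModusPonens (phi := Top)); [|exact T].
  apply Induction; apply imp_const; [exact H|exact (WkNextStep T)].
Qed.

(** [WkNextStep] under a prefix: [a] carries itself to the next position and yields [b] there. *)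
Lemma imp_wnext a b :
  derivable F (Imp a (WNext a)) -> derivable F (Imp a b) ->
  derivable F (Imp a (WNext b)).
Proof.
  intros Ha Hab; exact (imp_trans Ha (wnext_mono Hab)).
Qed.

Lemma imp_induction a b c :
  derivable F (Imp a (WNext a)) ->
  derivable F (Imp a (Imp b c)) -> derivable F (Imp a (Imp b (WNext b))) ->
  derivable F (Imp a (Imp b (Always c))).
Proof.
  intros Ha Hc Hb.
  apply imp_curry, Induction; [exact (imp_uncurry Hc)|].
  (* Both halves of the invariant [And a b] persist: [b] by [Hb], which may use [a], and [a] by [Ha]
     alone; [wnext_and] rejoins them. *)
  apply imp_mp with (WNext b); [|exact (imp_uncurry Hb)].
  apply imp_trans with (WNext a); [|apply wnext_and].
  apply imp_uncurry, imp_trans with (1 := Ha).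
  by_tautology (WNext a) b a.
Qed.

End Derivability.

Theorem theorem4p3 (Var : Type) (F : Ensemble (formula Var))
    (phi psi : formula Var) :
  derivable (Union _ F (Singleton _ phi)) psi <->
  derivable F (Imp (Always phi) psi).
Proof.
  split.
  - intro D; induction D as [chi H| p s H | | | | | | |].
    + destruct H as [chi H|chi H].
      * apply imp_const, Assumption, H.
      (* The axiom is [phi] itself. *)
      * destruct H; apply always_now.
    + apply imp_const, Tautology, H.
    + eapply imp_mp; eassumption.
    + apply imp_const, WkNextDistr.
    + apply imp_const, EndNextContra.
    + apply imp_const, Finite.
    + apply imp_const, WkUntilUnroll.
    + apply imp_wnext; [apply always_wnext|assumption].
    + apply imp_induction; [apply always_wnext|assumption|assumption].
  (* With [phi] as an axiom, [Always phi] is derivable and discharges the antecedent. *)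
  - intro D; apply (ModusPonens (phi := Always phi)).
    + apply derivable_weaken with (2 := D).
      intros chi H; left; exact H.
    + apply always_intro, Assumption; right; constructor.
Qed.
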